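(* Let $N\ge 4$ be even, let $\varphi\in\mathbb R$, and let $\vartheta\in\frac{2\pi}{N}\mathbb Z$. Then $$\operatorname{spec} A_N(\varphi,\vartheta)\subset \mathcal X_{\varphi/2}.$$ More precisely, if $z\in\operatorname{spec}A_N(\varphi,\vartheta)$, then $$z\in e^{i\varphi/2}\mathbb R\ \Longrightarrow\ |z|\le 2|\cos(\varphi/2)|,\qquad z\in e^{i(\varphi/2+\pi/2)}\mathbb R\ \Longrightarrow\ |z|\le 2|\sin(\varphi/2)|.$$
   Context: Indices of $\mathbb C^N$ are taken in $\mathbb Z/N\mathbb Z$, with standard basis $(e_j)_{j\in\mathbb Z/N\mathbb Z}$. Let $S e_j=e_{j+1}$ be the periodic shift and set $$C_N=\frac{S+S^{-1}}2,\qquad D_N(\vartheta)=\operatorname{diag}\Bigl(\cos\bigl(\tfrac{2\pi j}{N}+\vartheta\bigr)\Bigr)_{j\in\mathbb Z/N\mathbb Z},\qquad A_N(\varphi,\vartheta)=e^{i\varphi}C_N+D_N(\vartheta).$$ For $\alpha\in\mathbb R$, $\mathcal X_\alpha:=e^{i\alpha}\mathbb R\cup e^{i(\alpha+\pi/2)}\mathbb R\subset\mathbb C$ (union of two perpendicular lines through $0$). *)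

(* Defs.v *)
From mathcomp Require Import all_boot all_order all_algebra.
From mathcomp Require Import complex.
From mathcomp Require Import boolp classical_sets reals trigo.

Set Implicit Arguments.
Unset Strict Implicit.
Unset Printing Implicit Defensive.

Import Order.TTheory GRing.Theory Num.Theory.
Local Open Scope ring_scope.
Local Open Scope complex_scope.
Local Open Scope classical_set_scope.

Definition expi (R : realType) (a : R) : R[i] := cos a +i* sin a.

(* Matrices act on column vectors; the index set Z/NZ is 'I_N with the cyclic
   successor ordS, so that this is the matrix with S e_j = e_(j+1). *)
Definition shiftmx (R : realType) (N : nat) : 'M[R[i]]_N :=
  \matrix_(i, j) (i == ordS j)%:R.

Lemma shiftmx_basis (R : realType) (N : nat) (j : 'I_N) :
  shiftmx R N *m delta_mx j (0 : 'I_1) = delta_mx (ordS j) 0.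
Proof.
by apply/matrixP => i k; rewrite -colE !mxE ord1 eqxx andbT.
Qed.

(* Hence invmx (shiftmx R N), which is only junk on singular matrices, is a
   genuine inverse. *)
Lemma shiftmx_unit (R : realType) (N : nat) : shiftmx R N \in unitmx.
Proof.
suff /mulmx1_unit[] : shiftmx R N *m (shiftmx R N)^T = 1%:M by [].
apply/matrixP => i k; rewrite !mxE (bigD1 (ord_pred i)) //= !mxE ord_predK eqxx.
rewrite mul1r big1 ?addr0 => [|j ji]; first by rewrite eq_sym.
by rewrite !mxE -(inj_eq (@ord_pred_inj N)) ordSK eq_sym (negPf ji) mul0r.
Qed.

Definition Cmx (R : realType) (N : nat) : 'M[R[i]]_N :=
  2^-1 *: (shiftmx R N + invmx (shiftmx R N)).

(* The entry depends on j only modulo N, so using the representative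
   0 <= j < N is harmless. *)
Definition Dmx (R : realType) (N : nat) (theta : R) : 'M[R[i]]_N :=
  diag_mx (\row_j (cos (2 * pi * j%:R / N%:R + theta))%:C).

Definition Amx (R : realType) (N : nat) (phi theta : R) : 'M[R[i]]_N :=
  expi phi *: Cmx R N + Dmx N theta.

Definition spec (R : realType) (N : nat) (A : 'M[R[i]]_N) : set R[i] :=
  [set z | eigenvalue A z].

(* eigenvalue is stated with row vectors; the set of eigenvalues
   is the same for columns. *)
Lemma specP (R : realType) (N : nat) (A : 'M[R[i]]_N) (z : R[i]) :
  spec A z <-> exists2 v : 'cV_N, A *m v = z *: v & v != 0.
Proof.
have -> : spec A z = eigenvalue A^T z.
  by rewrite /spec /= !eigenvalue_root_char /char_poly -det_tr /char_poly_mx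
    linearB /= tr_scalar_mx map_trmx.
split=> [/eigenvalueP[v vA v0]|[v vA v0]].
  exists v^T; last by rewrite -trmx0 (inj_eq trmx_inj).
  by rewrite -[A]trmxK -trmx_mul vA linearZ.
apply/eigenvalueP; exists v^T; last by rewrite -trmx0 (inj_eq trmx_inj).
by rewrite -trmx_mul vA linearZ.
Qed.

(* The real line e^(i alpha) R in the complex plane. *)
Definition cline (R : realType) (alpha : R) : set R[i] :=
  [set expi alpha * t%:C | t in [set: R]].

Definition cross (R : realType) (alpha : R) : set R[i] :=
  cline alpha `|` cline (alpha + pi / 2).

(* Main.v *)
(** Write omega = exp(2 i pi / N), S for the shift and U = diag(omega^x), where
    x = j + k when theta = 2 pi k / N, so that D = (U + U^-1) / 2. In an
    eigenbasis (f_l) of S U^-1, both S and U map f_l to a multiple of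
    f_(l-1). Hence B = e^(-i phi/2) A has zero diagonal and only links
    neighbours: with h_l = pi (l + 1/2) / N,
      B f_l = e^(-i h_l) cos(phi/2 - h_l) f_(l+1)
              + e^(i h_(l-1)) cos(phi/2 + h_(l-1)) f_(l-1).
    There is a real diagonal w with w B Hermitian. It satisfies
    w_(l+1) cos(phi/2 - h_l) = w_l cos(phi/2 + h_l), and closes up around the
    cycle because h_(N-1-l) = pi - h_l and N is even. As B exchanges the two
    parity classes of sites, an eigenvector v of B whose eigenvalue has a
    non-real square satisfies sum w_l |v_l|^2 = 0 over each parity class. The
    sign of w_l w_(l+1) is that of cos phi + cos (2 h_l), which is positive on
    an arc of evenly many links and nonpositive on the complementary arc, so
    w has constant sign on one of the two classes and v vanishes there, hence
    everywhere. If some link vanishes, w degenerates; the cycle then falls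
    apart into two paths, on each of which this product has constant sign, and
    the same argument applies to one path after the other.

    The bounds on |z| follow from the numerical range: <C v, v> and <D v, v>
    are real and at most |v|^2 in absolute value. *)

Require Import Defs.
From mathcomp Require Import all_boot all_order all_algebra.
From mathcomp Require Import complex.
From mathcomp Require Import boolp classical_sets reals trigo.
From mathcomp Require Import ring lra zify.
Set Implicit Arguments.
Unset Strict Implicit.

Import Order.TTheory GRing.Theory Num.Theory.
Local Open Scope ring_scope.

(** * Weighted Hermitian forms on a chain of sites *)

(** Pairing the recurrence with [eps ^+ i * w i.+1 * (V i.+1)^*] gives z T = X + eps X^*, where T is
    the weighted sum and X collects the terms [e]. Since T is real, conjugation yields z^* T = eps z
    T. The terms [f] and [e] of an interior link are conjugate by the symmetry of w, and the
    boundary hypothesis pairs the two end links. *)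
Lemma chain_form (C : numClosedFieldType) (L : nat) (w a b V : nat -> C)
    (z eps : C) :
  eps^* = eps -> eps * eps = 1 -> (forall i, w i \is Num.real) ->
  (forall i, (i < L)%N -> z * V i.+1 = a i * V i + b i.+1 * V i.+2) ->
  (forall i, (0 < i < L)%N -> w i.+1 * a i = w i * (b i)^*) ->
  w 1%N * (V 1%N)^* * a 0%N * V 0%N
    = eps ^+ L * (w L * (V L)^* * b L * V L.+1)^* ->
  (z^* - eps * z) * (\sum_(i < L) eps ^+ i * (w i.+1 * `|V i.+1| ^+ 2)) = 0.
Proof.
move=> epsC eps2 wR rec herm bdry.
have wC i : (w i)^* = w i by apply/CrealP.
pose e i := w i * (V i)^* * b i * V i.+1.
pose f i := w i.+1 * (V i.+1)^* * a i * V i.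
have fE i : (0 < i < L)%N -> f i = (e i)^*.
  move=> iL; rewrite /f /e !rmorphM /= conjCK wC.
  rewrite -(mulrA (w i)) (mulrC (V i)) !mulrA -[_ * a i]mulrA (mulrC _ (a i)).
  by rewrite mulrA herm //; ring.
set T := \sum_(i < L) _.
pose X := \sum_(i < L) eps ^+ i * e i.+1.
have XE : eps * X^* = \sum_(i < L) eps ^+ i * f i.
  rewrite /X rmorph_sum mulr_sumr.
  under eq_bigr => i _ do rewrite rmorphM rmorphXn /= epsC mulrA -exprS.
  case: L @T X bdry {rec herm} fE => [|L] T X bdry fE; first by rewrite !big_ord0.
  rewrite big_ord_recr [RHS]big_ord_recl /= expr0 mul1r /f {1}bdry addrC.
  congr (_ + _); apply: eq_bigr => i _.
  by rewrite /bump /= -/(f _) fE //= ltnS ltn_ord.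
have zT : z * T = X + eps * X^*.
  rewrite XE /X -big_split /T mulr_sumr /=; apply: eq_bigr => i _.
  rewrite normCK /e /f -mulrDr.
  transitivity (eps ^+ i * w i.+1 * (V i.+1)^* * (z * V i.+1)); first by ring.
  by rewrite rec //; ring.
have TC : T^* = T.
  rewrite /T rmorph_sum; apply: eq_bigr => i _ /=.
  by rewrite !rmorphM !rmorphXn /= epsC wC (CrealP (normr_real _)).
have : z^* * T = eps * (z * T).
  rewrite -[in LHS]TC -rmorphM zT rmorphD rmorphM /= conjCK epsC mulrDr mulrA.
  by rewrite eps2 mul1r addrC.
by move=> h; rewrite mulrBl h -mulrA subrr.
Qed.

(* Combining eps = 1 and eps = -1 isolates the sites of one parity. *)
Lemma chain_sublattice (C : numClosedFieldType) (L : nat) (w a b V : nat -> C)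
    (z : C) (c : bool) :
  z^* != z -> z^* != - z -> (forall i, w i \is Num.real) ->
  (forall i, (i < L)%N -> z * V i.+1 = a i * V i + b i.+1 * V i.+2) ->
  (forall i, (0 < i < L)%N -> w i.+1 * a i = w i * (b i)^*) ->
  (forall eps, eps = 1 \/ eps = -1 -> w 1%N * (V 1%N)^* * a 0%N * V 0%N
    = eps ^+ L * (w L * (V L)^* * b L * V L.+1)^*) ->
  (forall i j, (0 < i <= L)%N -> (0 < j <= L)%N -> odd i = c -> odd j = c ->
     0 <= w i * w j) ->
  forall i, (0 < i <= L)%N -> odd i = c -> w i * V i = 0.
Proof.
move=> z1 z2 wR rec herm bdry ww.
have T1 : \sum_(i < L) 1 ^+ i * (w i.+1 * `|V i.+1| ^+ 2) = 0.
  have /(_ 1) := @chain_form _ L w a b V z _ _ _ wR rec herm (bdry _ _).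
  move=> /(_ (rmorph1 _) (mulr1 _) (or_introl erefl))/eqP.
  by rewrite mul1r mulf_eq0 subr_eq0 (negPf z1) => /eqP.
have T2 : \sum_(i < L) (-1) ^+ i * (w i.+1 * `|V i.+1| ^+ 2) = 0.
  have /(_ (-1)) := @chain_form _ L w a b V z _ _ _ wR rec herm (bdry _ _).
  move=> /(_ (rmorphN1 _)); rewrite mulrNN mulr1.
  move=> /(_ erefl (or_intror erefl))/eqP.
  by rewrite mulN1r mulf_eq0 subr_eq0 (negPf z2) => /eqP.
have T3 : \sum_(i < L) (odd i.+1 == c)%:R * (w i.+1 * `|V i.+1| ^+ 2) = 0.
  have : \sum_(i < L) 2 * ((odd i.+1 == c)%:R * (w i.+1 * `|V i.+1| ^+ 2)) = 0.
    transitivity (\sum_(i < L) 1 ^+ i * (w i.+1 * `|V i.+1| ^+ 2)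
      + (if c then 1 else -1) *
        \sum_(i < L) (-1) ^+ i * (w i.+1 * `|V i.+1| ^+ 2)); last first.
      by rewrite T1 T2 mulr0 addr0.
    rewrite mulr_sumr -big_split /=; apply: eq_bigr => i _.
    rewrite expr1n -signr_odd /=.
    by case: c {ww} (odd i) => [] [] /=; rewrite ?(expr0, expr1) /=; ring.
  rewrite -mulr_sumr => /eqP; rewrite mulf_eq0 pnatr_eq0 /=.
  by move/eqP.
move=> j jL jc.
(* The common sign of the weights on this class is unknown; the factor [w j] makes every term
   nonnegative, so each one vanishes. *)
have /eqP : \sum_(i < L) w j * ((odd i.+1 == c)%:R *
    (w i.+1 * `|V i.+1| ^+ 2)) = 0 by rewrite -mulr_sumr T3 mulr0.
rewrite psumr_eq0; last first.
  move=> i _; case: eqP => ic; last by rewrite mul0r mulr0.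
  by rewrite mul1r mulrA mulr_ge0 ?exprn_ge0 ?ww //= ltn_ord.
case: j jL jc => // j /= jL jc /allP/(_ (Ordinal jL)).
rewrite mem_index_enum /= => /(_ isT); rewrite jc eqxx mul1r mulrA.
have -> : w j.+1 * w j.+1 * `|V j.+1| ^+ 2 = (w j.+1 * `|V j.+1|) ^+ 2 by ring.
by rewrite sqrf_eq0 !mulf_eq0 normr_eq0 -mulf_eq0 => /eqP.
Qed.

(* Sites are 1, ..., L and link l joins l to l + 1; links 0 and L lead out of
   the chain, or close it into a cycle. *)
Definition chain_weight (C : comNzRingType) (alpha beta : nat -> C) (L j : nat) : C :=
  \prod_(1 <= l < j) beta l * \prod_(j <= l < L) alpha l.

(** This is the relation that makes w B Hermitian; the product form of w solves it without
    division. *)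
Lemma chain_weightS (C : comNzRingType) (alpha beta : nat -> C) (L i : nat) :
  (0 < i < L)%N -> chain_weight alpha beta L i.+1 * alpha i
    = chain_weight alpha beta L i * beta i.
Proof.
move=> /andP[i0 iL]; rewrite /chain_weight big_nat_recr //=.
by rewrite [X in _ = _ * X * _]big_ltn //; ring.
Qed.

(** In the product of two weights the links outside [i, j) enter squared and those inside enter
    once, as [alpha l * beta l]; the signs of the latter telescope through [t]. *)
Lemma chain_weight_sign (C : numClosedFieldType) (alpha beta : nat -> C)
    (L : nat) (t : nat -> bool) (i j : nat) :
  (forall l, alpha l \is Num.real) -> (forall l, beta l \is Num.real) ->
  (forall l, (0 < l < L)%N ->
     0 <= (-1) ^+ (t l (+) t l.+1) * (alpha l * beta l)) ->
  (0 < i)%N -> (i <= j <= L)%N -> t i = false -> t j = false ->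
  0 <= chain_weight alpha beta L i * chain_weight alpha beta L j.
Proof.
move=> aR bR ts i0 /andP[ij jL] ti tj.
have -> : chain_weight alpha beta L i * chain_weight alpha beta L j
    = (\prod_(1 <= l < i) beta l) ^+ 2 * (\prod_(j <= l < L) alpha l) ^+ 2
      * \prod_(i <= l < j) (alpha l * beta l).
  rewrite /chain_weight (@big_cat_nat _ _ _ j i L) //= (@big_cat_nat _ _ _ i 1 j) //=.
  by rewrite big_split /=; ring.
have pR F n m : (forall l, F l \is Num.real) ->
    \prod_(n <= l < m) F l \is @Num.real C.
  by move=> FR; apply: rpred_prod => ? _; apply: FR.
apply: mulr_ge0; first by rewrite mulr_ge0 // real_exprn_even_ge0 // pR.
suff : 0 <= (-1) ^+ (t i (+) t j) * \prod_(i <= l < j) (alpha l * beta l).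
  by rewrite ti tj mul1r.
move: ij jL; clear tj; elim: j => [|j IH]; first by lia.
rewrite leq_eqVlt => /orP[/eqP <- _|]; first by rewrite addbb big_geq // mul1r.
rewrite ltnS => ij jL; rewrite big_nat_recr //=.
have -> : t i (+) t j.+1 = (t i (+) t j) (+) (t j (+) t j.+1).
  by case: (t i) (t j) (t j.+1) => [] [] [].
rewrite signr_addb mulrACA mulr_ge0 ?IH ?ts //; lia.
Qed.

(** The class of parity [c] is the one on which the weights share a sign. The alternative in the
    hypotheses covers a path cut off at both ends and a cycle of even length around which the weight
    closes up. *)
Lemma chain_vanish (C : numClosedFieldType) (L : nat)
    (alpha beta kappa V : nat -> C) (z : C) (c : bool) (t : nat -> bool) :
  z^* != z -> z^* != - z ->
  (forall l, alpha l \is Num.real) -> (forall l, beta l \is Num.real) ->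
  (forall l, (0 < l < L)%N -> alpha l * beta l != 0) ->
  (forall i, (i < L)%N -> z * V i.+1
     = (kappa i)^* * alpha i * V i + kappa i.+1 * beta i.+1 * V i.+2) ->
  (forall l, (0 < l < L)%N ->
     0 <= (-1) ^+ (t l (+) t l.+1) * (alpha l * beta l)) ->
  (forall i, (0 < i <= L)%N -> odd i = c -> t i = false) ->
  (alpha 0%N * V 0%N = 0 /\ beta L * V L.+1 = 0) \/
  [/\ ~~ odd L, V 0%N = V L, V L.+1 = V 1%N &
     \prod_(1 <= l < L) alpha l * ((kappa 0%N)^* * alpha 0%N)
       = \prod_(1 <= l < L) beta l * ((kappa L)^* * beta L)] ->
  forall i, (0 < i <= L)%N -> V i = 0.
Proof.
move=> z1 z2 aR bR ab0 rec ts tc bdry.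
have z0 : z != 0 by apply: contraNneq z1 => ->; rewrite conjC0.
have aC l : (alpha l)^* = alpha l by apply/CrealP.
have bC l : (beta l)^* = beta l by apply/CrealP.
pose w := chain_weight alpha beta L.
have wR i : w i \is Num.real.
  by rewrite /w /chain_weight rpredM // rpred_prod // => ? _.
have w0 i : (0 < i <= L)%N -> w i != 0.
  move=> iL; rewrite /w /chain_weight mulf_neq0 // prodf_seq_neq0;
    apply/allP => l; rewrite mem_index_iota => hl /=;
    have := ab0 l; rewrite mulf_eq0 negb_or => /(_ _)/andP[] //; lia.
have Vc i : (0 < i <= L)%N -> odd i = c -> V i = 0.
  move=> iL ic.
  have : w i * V i = 0.
    apply: (@chain_sublattice C L w (fun i => (kappa i)^* * alpha i)
      (fun i => kappa i * beta i) V z c) => //.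
    - move=> l lL; rewrite rmorphM /= bC !(mulrCA _ (kappa l)^*).
      by rewrite chain_weightS.
    - have [L0|L0] := posnP L.
        by move: iL; rewrite L0; lia.
      move=> eps heps; case: bdry => [[h0 hL]|[oL V0 VL P]].
        have -> : w L * (V L)^* * (kappa L * beta L) * V L.+1
           = w L * (V L)^* * kappa L * (beta L * V L.+1) by ring.
        have -> : w 1%N * (V 1%N)^* * ((kappa 0%N)^* * alpha 0%N) * V 0%N
           = w 1%N * (V 1%N)^* * (kappa 0%N)^* * (alpha 0%N * V 0%N) by ring.
        by rewrite h0 hL !mulr0 conjC0 mulr0.
      have -> : eps ^+ L = 1.
        by case: heps => ->; rewrite ?expr1n // -signr_odd (negPf oL).
      have wC : (w L)^* = w L by apply/CrealP.
      have conjE (x v k y u : C) : x^* = x -> y^* = y ->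
          (x * v^* * (k * y) * u)^* = x * v * (k^* * y) * u^*.
        by move=> xC yC; rewrite !rmorphM /= conjCK xC yC.
      rewrite mul1r conjE // VL V0.
      have -> : w L = \prod_(1 <= l < L) beta l.
        by rewrite /w /chain_weight [X in _ * X]big_geq // mulr1.
      have -> : w 1%N = \prod_(1 <= l < L) alpha l.
        by rewrite /w /chain_weight big_geq // mul1r.
      transitivity (\prod_(1 <= l < L) alpha l * ((kappa 0%N)^* * alpha 0%N)
         * (V 1%N)^* * V L); first by ring.
      by rewrite P; ring.
    - move=> j k jL kL jc kc.
      have [jk|kj] := leqP j k; last rewrite mulrC;
      apply: (@chain_weight_sign C alpha beta L t) => //; try lia; exact: tc.
  by move/eqP; rewrite mulf_eq0 (negPf (w0 _ iL)) => /eqP.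
(* At a site of the other class, z V is a combination of neighbours of parity [c], and z is nonzero.
   At the ends of a cycle the neighbours wrap around, and even L gives them parity [c] as well. *)
case=> // i iL.
have [ic|ic] := eqVneq (odd i.+1) c; first exact: Vc.
apply/eqP; rewrite -(inj_eq (mulfI z0)) mulr0 rec //; apply/eqP.
rewrite -!mulrA.
have -> : alpha i * V i = 0.
  case: i iL ic => [|i] iL ic.
    case: bdry => [[]//|[oL V0 _ _]].
    rewrite V0 Vc ?mulr0 ?leqnn ?andbT //.
    by rewrite (negPf oL); move: ic; case: c {tc Vc}.
  rewrite Vc ?mulr0 //; first lia.
  by move: ic => /=; case: c {tc Vc} (odd i) => [] [].
have -> : beta i.+1 * V i.+2 = 0.
  have [iL1|iL1] := leqP L i.+1; last first.
    rewrite Vc ?mulr0 //.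
    by move: ic => /=; case: c {tc Vc} (odd i) => [] [].
  have EL : i.+1 = L by lia.
  rewrite EL; case: bdry => [[]//|[oL _ VL _]].
  rewrite VL Vc ?mulr0 //; first lia.
  by move: ic; rewrite EL (negPf oL); case: c {tc Vc}.
by rewrite !mulr0 addr0.
Qed.

(** For s > 0 all weights have the same sign, for s < 0 they alternate; in both cases the even sites
    share a sign. *)
Lemma path_vanish (C : numClosedFieldType) (L : nat)
    (alpha beta kappa V : nat -> C) (z s : C) :
  z^* != z -> z^* != - z ->
  (forall l, alpha l \is Num.real) -> (forall l, beta l \is Num.real) ->
  s \is Num.real ->
  (forall l, (0 < l < L)%N -> 0 < s * (alpha l * beta l)) ->
  (forall i, (i < L)%N -> z * V i.+1
     = (kappa i)^* * alpha i * V i + kappa i.+1 * beta i.+1 * V i.+2) ->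
  alpha 0%N * V 0%N = 0 -> beta L * V L.+1 = 0 ->
  forall i, (0 < i <= L)%N -> V i = 0.
Proof.
move=> z1 z2 aR bR sR sp rec h0 hL.
apply: (@chain_vanish C L alpha beta kappa V z false
          (fun i => if 0 < s then false else odd i)) => //.
- by move=> l /sp; apply: contraTneq => ->; rewrite mulr0 ltxx.
- move=> l /sp; case: ifPn => [s0|]; first by rewrite addbb mul1r pmulr_rgt0 // => /ltW.
  rewrite -real_leNgt ?real0 // => s0 sab /=.
  have {}s0 : s < 0.
    rewrite lt_neqAle s0 andbT; apply: contraTneq sab => ->.
    by rewrite mul0r ltxx.
  by rewrite addbN addbb mulN1r oppr_ge0 ltW // -(nmulr_rgt0 _ s0).
- by move=> i _ io; case: ifP.
- by left.
Qed.

(** * Signs and reflection symmetry of the link amplitudes *)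

Local Open Scope complex_scope.

(* Half angle of link l, and the amplitudes from site l to l + 1 (fwd) and back
   (bwd), up to the phases expi (- hang R N l) and expi (hang R N l). *)
Definition hang (R : realType) (N l : nat) : R := pi * (l%:R + 2^-1) / N%:R.
Definition fwd (R : realType) (N : nat) (phi : R) (l : nat) : R := cos (phi / 2 - hang R N l).
Definition bwd (R : realType) (N : nat) (phi : R) (l : nat) : R := cos (phi / 2 + hang R N l).

Section Links.
Context (R : realType) (N : nat) (phi : R).
Hypothesis N0 : (0 < N)%N.
Let NR : N%:R != 0 :> R. Proof. by rewrite pnatr_eq0 -lt0n. Qed.

(** The reflection l -> qN - 1 - l of the cycle; q = 2 serves when the mirror image is taken in the
    next period. *)
Lemma hang_rev (l m q : nat) : (l + m).+1 = (q * N)%N ->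
  hang R N m = q%:R * pi - hang R N l.
Proof.
move=> lm; have lmR : l%:R + m%:R + 1 = q%:R * N%:R :> R.
  by rewrite -natrM -lm -addn1 !natrD.
rewrite /hang; have -> : m%:R = q%:R * N%:R - 1 - l%:R :> R by rewrite -lmR; ring.
by field.
Qed.

Lemma cosD_natpi (x : R) (q : nat) : cos (x + q%:R * pi) = (-1) ^+ q * cos x.
Proof.
elim: q => [|q IH]; first by rewrite mul0r addr0 mul1r.
rewrite -natr1 mulrDl mul1r addrA cosDpi IH exprS; ring.
Qed.

Lemma bwd_rev (l m q : nat) : (l + m).+1 = (q * N)%N ->
  bwd N phi m = (-1) ^+ q * fwd N phi l.
Proof.
move=> lm; rewrite /bwd (hang_rev lm) /fwd -cosD_natpi; congr cos; ring.
Qed.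

Lemma fwd_bwd (l : nat) :
  fwd N phi l * bwd N phi l = (cos phi + cos (2 * hang R N l)) / 2.
Proof.
have c2 (x : R) : cos (2 * x) = 1 - 2 * sin x ^+ 2.
  by rewrite mulr2n mulrDl mul1r cosD -expr2 cos2sin2; ring.
have -> : cos phi = cos (2 * (phi / 2)) by congr cos; field.
rewrite !c2 /fwd /bwd cosB cosD.
transitivity (cos (phi / 2) ^+ 2 * cos (hang R N l) ^+ 2 -
  sin (phi / 2) ^+ 2 * sin (hang R N l) ^+ 2); first by ring.
by rewrite !cos2sin2; field.
Qed.

Lemma hangB (l m : nat) : hang R N l - hang R N m = pi * (l%:R - m%:R) / N%:R.
Proof. by rewrite /hang; field. Qed.

Lemma sin_hangB_gt0 (l m : nat) : (m < l < m + N)%N ->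
  0 < sin (hang R N l - hang R N m).
Proof.
move=> /andP[ml lm]; rewrite hangB sin_gt0_pi //; first last.
- have NR0 : 0 < N%:R :> R by rewrite ltr0n.
  rewrite ltr_pdivrMr // ltr_pM2l ?pi_gt0 // ltrBlDl -natrD ltr_nat //.
- by rewrite divr_gt0 ?ltr0n // mulr_gt0 ?pi_gt0 // subr_gt0 ltr_nat.
Qed.

Lemma cos_sin_nz (x : R) : cos x = 0 -> sin x != 0.
Proof.
by move=> c0; apply/eqP => s0; have := cos2Dsin2 x; rewrite c0 s0; lra.
Qed.

(** The zero of [fwd] at m is mirrored by a zero of [bwd] at M. Measured from these zeros, the
    amplitudes are multiples of sin (h_l - h_m) and sin (h_l - h_M), and only the second sine
    changes sign on the way from m to m + N. *)
Lemma links_arcs (m : nat) : ~~ odd N -> (m < N)%N -> fwd N phi m = 0 ->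
  exists M (s : R), [/\ (m < M < m + N)%N, bwd N phi M = 0,
    forall l, (m < l < M)%N -> 0 < s * (fwd N phi l * bwd N phi l) &
    forall l, (M < l < m + N)%N -> 0 < - s * (fwd N phi l * bwd N phi l)].
Proof.
move=> evN mN a0.
(* M is the mirror image of m, moved into the period after m; it differs from m because N is
   even. *)
have [M [q [mM qN]]] : exists M q, (m < M < m + N)%N /\ (m + M).+1 = (q * N)%N.
  have [h|h] := ltnP m (N.-1 - m).
    by exists (N.-1 - m)%N, 1%N; split; lia.
  exists (N + (N.-1 - m))%N, 2%N; split; last lia.
  suff : (m.*2.+1 != N) by lia.
  by apply: contraNneq evN => <-; rewrite /= odd_double.
have b0 : bwd N phi M = 0 by rewrite (bwd_rev qN) a0 mulr0.
pose u := phi / 2 - hang R N m; pose v := phi / 2 + hang R N M.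
have aE l : fwd N phi l = sin u * sin (hang R N l - hang R N m).
  rewrite /fwd; have -> : phi / 2 - hang R N l = u - (hang R N l - hang R N m).
    by rewrite /u; ring.
  by rewrite cosB [cos u]a0 mul0r add0r.
have bE l : bwd N phi l = - sin v * sin (hang R N l - hang R N M).
  rewrite /bwd; have -> : phi / 2 + hang R N l = v + (hang R N l - hang R N M).
    by rewrite /v; ring.
  by rewrite cosD [cos v]b0 mul0r sub0r mulNr.
have w0 : 0 < (sin u * sin v) ^+ 2.
  by rewrite exprn_even_gt0 //= mulf_neq0 //; apply: cos_sin_nz.
exists M, (sin u * sin v); split => // l lM; rewrite aE bE.
- have h1 : 0 < sin (hang R N l - hang R N m) by apply: sin_hangB_gt0; lia.
  have h2 : 0 < sin (hang R N M - hang R N l) by apply: sin_hangB_gt0; lia.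
  have -> : hang R N l - hang R N M = - (hang R N M - hang R N l) by ring.
  rewrite sinN; have := mulr_gt0 w0 (mulr_gt0 h1 h2); congr (0 < _); ring.
- have h1 : 0 < sin (hang R N l - hang R N m) by apply: sin_hangB_gt0; lia.
  have h2 : 0 < sin (hang R N l - hang R N M) by apply: sin_hangB_gt0; lia.
  have := mulr_gt0 w0 (mulr_gt0 h1 h2); congr (0 < _); ring.
Qed.

(** The sign is that of cos phi + cos (2 h_l), which decreases along the first half of the cycle,
    where 2 h_l stays in [0, pi], and is symmetric under l -> N - 1 - l. *)
Lemma links_sign : ~~ odd N -> exists2 k, (k.*2 <= N)%N &
  forall l, (l < N)%N ->
    0 <= (-1) ^+ (k <= l < N - k)%N * (fwd N phi l * bwd N phi l).
Proof.
move=> evN.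
have NR0 : 0 < N%:R :> R by rewrite ltr0n.
have rev l m : (l + m).+1 = N ->
    fwd N phi l * bwd N phi l = fwd N phi m * bwd N phi m.
  move=> lm; have qN : (l + m).+1 = (1 * N)%N by rewrite mul1n.
  have qN' : (m + l).+1 = (1 * N)%N by rewrite mul1n addnC.
  by rewrite (bwd_rev qN) (bwd_rev qN'); ring.
pose P l := fwd N phi l * bwd N phi l <= 0.
have Pmono l m : (l <= m < N./2)%N -> P l -> P m.
  move=> /andP[lm mn]; rewrite /P !fwd_bwd => Pl.
  suff : cos (2 * hang R N m) <= cos (2 * hang R N l) by lra.
  have hb j : (j < N./2)%N -> 2 * hang R N j \in `[0, pi].
    move=> jn; rewrite in_itv /=; apply/andP; split.
      have p0 := pi_ge0 R; have j0 : 0 <= j%:R + 2^-1 :> R by have := ler0n R j; lra.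
      have h0 : 0 <= hang R N j by apply: divr_ge0; [exact: mulr_ge0|exact: ltW].
      by rewrite mulr_ge0.
    rewrite /hang mulrA ler_pdivrMr //.
    have -> : 2 * (pi * (j%:R + 2^-1)) = pi * (2 * j%:R + 1) :> R by field.
    rewrite ler_pM2l ?pi_gt0 // -natrM natr1 ler_nat; lia.
  have ln : (l < N./2)%N by lia.
  rewrite leNgt (ltr_cos (hb _ mn) (hb _ ln)) -leNgt.
  rewrite ler_pM2l // ler_pM2r ?invr_gt0 // ler_pM2l ?pi_gt0 //.
  by rewrite lerD2r ler_nat.
(* The first link with nonpositive product; if there is none, [find] returns [N./2] and the arc [k,
   N - k) is empty. *)
pose k := find P (iota 0 N./2).
have kn : (k <= N./2)%N by rewrite -[X in (_ <= X)%N](size_iota 0) find_size.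
have Plt l : (l < k)%N -> 0 <= fwd N phi l * bwd N phi l.
  move=> lk; have := before_find 0%N lk; rewrite nth_iota ?add0n; last lia.
  by move/negbT; rewrite /P -ltNge => /ltW.
have Pge l : (k <= l < N./2)%N -> fwd N phi l * bwd N phi l <= 0.
  move=> kl; apply: (@Pmono k); first by [].
  have := @nth_find _ 0%N P (iota 0 N./2); rewrite -/k has_find size_iota -/k.
  rewrite nth_iota ?add0n; last lia.
  by apply; lia.
exists k; first lia.
move=> l lN; wlog ln : l lN / (l < N./2)%N.
  move=> wl; have [/wl->//|nl] := ltnP l N./2.
  have := wl (N.-1 - l)%N; rewrite (@rev (N.-1 - l)%N l); last lia.
  have -> : (k <= N.-1 - l < N - k)%N = (k <= l < N - k)%N by lia.
  by apply; lia.
case: (boolP (k <= l < N - k)%N) => h; first by rewrite mulN1r oppr_ge0 Pge //; lia.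
by rewrite mul1r Plt //; lia.
Qed.

End Links.

(** * Vanishing around the whole cycle *)

Lemma realC_real (R : rcfType) (x : R) : x%:C \is Num.real.
Proof. by rewrite complex_real. Qed.

Lemma periodic_chain_vanish (R : realType) (N : nat) (phi : R)
    (V : nat -> R[i]) (z : R[i]) :
  (0 < N)%N -> ~~ odd N -> z^* != z -> z^* != - z ->
  (forall i, V (i + N)%N = V i) ->
  (forall i, z * V i.+1 = (expi (hang R N i))^* * (fwd N phi i)%:C * V i
     + expi (hang R N i.+1) * (bwd N phi i.+1)%:C * V i.+2) ->
  forall i, (i < N)%N -> V i = 0.
Proof.
move=> N0 evN z1 z2 per rec.
case: (pickP (fun m : 'I_N => fwd N phi m == 0)) => [m /eqP a0|a0].
  have [M [s [mM b0 sO sI]]] := links_arcs N0 evN (ltn_ord m) a0.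
  have VO i : (m < i <= M)%N -> V i = 0.
    move=> mi; have -> : i = (m + (i - m))%N by lia.
    apply: (@path_vanish _ (M - m) (fun i => (fwd N phi (m + i))%:C)
      (fun i => (bwd N phi (m + i))%:C) (fun i => expi (hang R N (m + i)))
      (fun i => V (m + i)%N) z s%:C) => //; rewrite ?realC_real //.
    - by move=> l; rewrite realC_real.
    - by move=> l; rewrite realC_real.
    - by move=> l lM; rewrite -!rmorphM /= ltcR sO //; lia.
    - by move=> l _; rewrite !addnS rec.
    - by rewrite addn0 a0 mul0r.
    - by rewrite subnKC ?b0 ?mul0r //; lia.
    - lia.
  (* The outer neighbours M and m + N + 1 of this second path lie, modulo N, on the first one, where
     V already vanishes; this gives its boundary conditions. *)
  have VI i : (M < i <= m + N)%N -> V i = 0.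
    move=> mi; have -> : i = (M + (i - M))%N by lia.
    apply: (@path_vanish _ (m + N - M) (fun i => (fwd N phi (M + i))%:C)
      (fun i => (bwd N phi (M + i))%:C) (fun i => expi (hang R N (M + i)))
      (fun i => V (M + i)%N) z (- s)%:C) => //; rewrite ?realC_real //.
    - by move=> l; rewrite realC_real.
    - by move=> l; rewrite realC_real.
    - by move=> l lM; rewrite -!rmorphM /= ltcR sI //; lia.
    - by move=> l _; rewrite !addnS rec.
    - by rewrite addn0 VO ?mulr0 //; lia.
    - have -> : (M + (m + N - M).+1)%N = (m.+1 + N)%N by lia.
      by rewrite per VO ?mulr0 //; lia.
    - lia.
  have mN := ltn_ord m.
  move=> i iN; rewrite -per.
  have [im|mi] := leqP i m.
    have [|] := leqP (i + N)%N M => ?; [apply: VO|apply: VI]; lia.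
  rewrite per; have [|] := leqP i M => ?; [apply: VO|apply: VI]; lia.
have an0 l : (l < N)%N -> fwd N phi l != 0 by move=> lN; have := a0 (Ordinal lN) => /= ->.
have bE l : (l < N)%N -> bwd N phi l = - fwd N phi (N.-1 - l)%N.
  move=> lN; rewrite (@bwd_rev _ _ phi N0 (N.-1 - l)%N l 1%N) ?expr1 ?mulN1r //; lia.
have [k kN sk] := links_sign phi N0 evN.
(* Reflection turns each [fwd] into minus a [bwd], and the N signs cancel because N is even. This
   closes up the weight. *)
have prodE : \prod_(0 <= l < N) fwd N phi l = \prod_(0 <= l < N) bwd N phi l.
  rewrite [LHS]big_nat_rev /= add0n.
  transitivity (\prod_(0 <= l < N) (-1 * bwd N phi l)).
    apply: eq_big_nat => l lN; rewrite bE; last lia.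
    by rewrite mulrNN mul1r; congr fwd; lia.
  by rewrite big_split /= prodr_const_nat subn0 -signr_odd (negPf evN) mul1r.
(* The parity of the number of links of [k, N - k) below j. It is even at every j of the parity of
   k, since N - 2k is even. *)
pose t j := odd (minn (maxn j k) (N - k) - k).
have V0 i : (0 < i <= N)%N -> V i = 0.
  apply: (@chain_vanish _ N (fun i => (fwd N phi i)%:C)
      (fun i => (bwd N phi i)%:C) (fun i => expi (hang R N i)) V z (odd k) t) => //.
  - by move=> l; rewrite realC_real.
  - by move=> l; rewrite realC_real.
  - move=> l lN; rewrite -rmorphM /= fmorph_eq0 mulf_neq0 ?bE ?oppr_eq0 ?an0 //; lia.
  - move=> l lN; have -> : t l (+) t l.+1 = (k <= l < N - k)%N.
      rewrite /t; lia.
    have := sk l; rewrite -ler0c rmorphM /= rmorphXn rmorphN1 rmorphM /=; apply; lia.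
  - move=> j jN; rewrite /t; lia.
  right; split => //.
  - exact: esym (per 0%N).
  - exact: (per 1%N).
  (* One turn adds pi to the half angle, so the phase and [bwd] both change sign and their product
     is unchanged. *)
  - have h0 : hang R N N = hang R N 0 + 1%:R * pi.
      rewrite /hang; field; by rewrite pnatr_eq0; lia.
    have -> : bwd N phi N = - bwd N phi 0.
      by rewrite /bwd h0 addrA cosD_natpi mulN1r.
    have -> : expi (hang R N N) = - expi (hang R N 0).
      by rewrite /expi h0 mul1r cosDpi sinDpi.
    rewrite rmorphN rmorphN /= mulrNN.
    have := congr1 (fun x => (expi (hang R N 0))^* * x%:C) prodE.
    rewrite !(big_ltn N0) !rmorphM !rmorph_prod /= => prodE'.
    transitivity ((expi (hang R N 0))^* * ((fwd N phi 0)%:C *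
      \prod_(1 <= l < N) (fwd N phi l)%:C)); first by ring.
    by rewrite prodE'; ring.
move=> [|i] iN; last by apply: V0; lia.
by rewrite -(per 0%N) V0 ?add0n ?N0 /=.
Qed.

(** * Quadratic exponentials and the passage to the chain *)

Lemma sumrD (W : nmodType) (I : finType) (F G : I -> W) :
  \sum_i F i + \sum_i G i = \sum_i (F i + G i).
Proof. by rewrite big_split. Qed.

Section Expi.
Context (R : realType).
Implicit Types a b : R.

Lemma expiD a b : expi (a + b) = expi a * expi b.
Proof. by rewrite /expi cosD sinD; simpc; congr (_ +i* _); ring. Qed.

Lemma expi0 : expi (0 : R) = 1.
Proof. by rewrite /expi cos0 sin0. Qed.

Lemma expiNM a : expi (- a) * expi a = 1.
Proof. by rewrite -expiD addNr expi0. Qed.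

Lemma conj_expi a : Num.conj (expi a) = expi (- a).
Proof. change (conjc (expi a) = expi (- a)); by rewrite /expi cosN sinN. Qed.

Lemma cos_expi a : (cos a)%:C = (expi a + expi (- a)) / 2 :> R[i].
Proof.
have -> : expi a + expi (- a) = 2 * (cos a)%:C.
  by rewrite /expi cosN sinN; apply/eqP; rewrite eq_complex /=; apply/andP; split;
    apply/eqP; rewrite ?mulr0 ?mul0r; ring.
by rewrite mulrC mulKf // pnatr_eq0.
Qed.

Lemma expi_nat2pi (n : nat) : expi (2 * pi * n%:R : R) = 1.
Proof.
elim: n => [|n IH]; first by rewrite mulr0 expi0.
rewrite -(@natr1 _ n) mulrDr mulr1 expiD IH mul1r.
have -> : 2 * pi = pi *+ 2 :> R by rewrite mulr_natl.
by rewrite /expi cos2pi sin2pi.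
Qed.

Lemma expi_int2pi (k : int) : expi (2 * pi * k%:~R : R) = 1.
Proof.
case: (intP k) => [|n|n]; first by rewrite mulr0 expi0.
  exact: expi_nat2pi.
have := expiNM (2 * pi * n.+1%:R); rewrite expi_nat2pi mulr1 => <-.
by congr expi; rewrite rmorphN mulrN.
Qed.

End Expi.

(* exp(i pi (x^2 + 2 i x) / N): the functionals dual, up to scalars, to the
   eigenbasis of S U^-1, as functions of the position x. *)
Definition gauss (R : realType) (N i : nat) (x : R) : R[i] :=
  expi (pi * (x ^+ 2 + 2 * i%:R * x) / N%:R).

Section Gauss.
Context (R : realType) (N : nat).
Hypothesis N0 : (0 < N)%N.
Hypothesis evN : ~~ odd N.
Let NR : N%:R != 0 :> R. Proof. by rewrite pnatr_eq0 -lt0n. Qed.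

Lemma gaussS i (x : R) : gauss N i x * expi (2 * pi * x / N%:R) = gauss N i.+1 x.
Proof. by rewrite /gauss -expiD -(@natr1 _ i); congr expi; field. Qed.

(** Like multiplication by the phase of U in [gaussS], translation raises the index by one; this is
    why the transformed operator links only neighbours. *)
Lemma gauss_shift i (x : R) :
  gauss N i (x + 1) = expi (2 * hang R N i) * gauss N i.+1 x.
Proof. by rewrite /gauss /hang -expiD -(@natr1 _ i); congr expi; field. Qed.

(** Moving x = k by N adds the phase pi (2k + N + 2i), a multiple of 2 pi because N is even. *)
Lemma gaussDN i (k : int) : gauss N i (k%:~R + N%:R : R) = gauss N i (k%:~R).
Proof.
have EN : N%:R = 2 * (N./2)%:R :> R by rewrite -natrM; congr _%:R; lia.
transitivity (gauss N i (k%:~R) * expi (2 * pi * (k + N./2%:Z + i%:Z)%:~R : R)).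
  rewrite /gauss -expiD !rmorphD /= -!pmulrn; congr expi.
  have -> : pi * ((k%:~R + N%:R) ^+ 2 + 2 * i%:R * (k%:~R + N%:R)) / N%:R
    = pi * (k%:~R ^+ 2 + 2 * i%:R * k%:~R) / N%:R + pi * (2 * k%:~R + N%:R + 2 * i%:R) :> R
    by field.
  by rewrite {2}EN; ring.
by rewrite expi_int2pi mulr1.
Qed.

Lemma gauss_periodic i (k : int) : gauss N (i + N) (k%:~R : R) = gauss N i (k%:~R).
Proof.
rewrite -[RHS]mulr1 -(expi_int2pi R k) /gauss -expiD natrD; congr expi; by field.
Qed.

Lemma gauss_ordS i (k : int) (j : 'I_N) :
  gauss N i ((ordS j)%:R + k%:~R : R) = expi (2 * hang R N i) * gauss N i.+1 (j%:R + k%:~R).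
Proof.
rewrite -gauss_shift.
have [jN|jN] := ltnP j.+1 N.
  by rewrite /ordS /= modn_small // -(@natr1 _ j); congr gauss; ring.
have EN : N = j.+1 by have := ltn_ord j; lia.
have -> : (ordS j)%:R = 0 :> R by rewrite /ordS /= -EN modnn.
by rewrite add0r -gaussDN addrAC natr1 -EN addrC.
Qed.

(** Distinctness of the Vandermonde nodes in [gauss_inj]. *)
Lemma fourier_node_neq (k : int) (i j : 'I_N) : (i < j)%N ->
  expi (2 * pi * (j%:R + k%:~R) / N%:R) != expi (2 * pi * (i%:R + k%:~R) / N%:R) :> R[i].
Proof.
move=> ij; apply/eqP => e.
have : expi (2 * (pi * (j%:R - i%:R) / N%:R)) = 1 :> R[i].
  have -> : 2 * (pi * (j%:R - i%:R) / N%:R) = - (2 * pi * (i%:R + k%:~R) / N%:R)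
    + 2 * pi * (j%:R + k%:~R) / N%:R :> R by field.
  by rewrite expiD e expiNM.
move=> /(congr1 (@complex.Re R)) /=; rewrite mulr2n mulrDl mul1r cosD -!expr2 cos2sin2.
have /(sin_hangB_gt0 R N0) : (i < j < i + N)%N by rewrite ij ltn_addl.
rewrite hangB //; set s := sin _ => s0 h.
have : s * s = 0 by move: h; rewrite expr2; lra.
by move/eqP; rewrite mulf_eq0 orbb (gt_eqF s0).
Qed.

End Gauss.

Lemma mul_Amx_col (R : realType) (N : nat) (phi theta : R) (v : 'cV[R[i]]_N) j :
  (Amx N phi theta *m v) j 0 =
    expi phi / 2 * (v (ord_pred j) 0 + v (ordS j) 0)
    + (cos (2 * pi * j%:R / N%:R + theta))%:C * v j 0.
Proof.
have shiftE (w : 'cV[R[i]]_N) i : (shiftmx R N *m w) i 0 = w (ord_pred i) 0.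
  rewrite mxE (bigD1 (ord_pred i)) //= !mxE ord_predK eqxx mul1r big1 ?addr0 //.
  move=> l li; rewrite !mxE -(inj_eq (@ord_pred_inj N)) ordSK eq_sym (negPf li).
  by rewrite mul0r.
have invE : invmx (shiftmx R N) *m v = \col_i v (ordS i) 0.
  rewrite -[RHS](mulKmx (shiftmx_unit R N)); congr (_ *m _).
  by apply/matrixP => i l; rewrite ord1 shiftE mxE ord_predK.
rewrite /Amx /Cmx /Dmx mulmxDl -!scalemxAl mulmxDl invE mul_diag_mx !mxE.
have := shiftE v j; rewrite mxE => ->; ring.
Qed.

Definition gauss_sum (R : realType) (N : nat) (k : int) (v : 'cV[R[i]]_N)
    (i : nat) : R[i] :=
  \sum_(j < N) gauss N i (j%:R + k%:~R) * v j 0.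

(** The eigenvalue equation tested against [gauss N i.+1]: reindexing moves the shifts onto the
    functional, and the cosine diagonal splits into U and its inverse. *)
Lemma gauss_chain (R : realType) (N : nat) (phi : R) (k : int) (v : 'cV[R[i]]_N)
    (z : R[i]) (V := gauss_sum k v) :
  (0 < N)%N -> ~~ odd N ->
  Amx N phi (2 * pi / N%:R * k%:~R) *m v = z *: v ->
  forall i, expi (- (phi / 2)) * z * V i.+1 =
    (expi (hang R N i))^* * (fwd N phi i)%:C * V i
     + expi (hang R N i.+1) * (bwd N phi i.+1)%:C * V i.+2.
Proof.
move=> N0 evN Av i.
have NR : N%:R != 0 :> R by rewrite pnatr_eq0 -lt0n.
have VC : \sum_(j < N) gauss N i.+1 (j%:R + k%:~R) * v (ord_pred j) 0
    = expi (2 * hang R N i.+1) * V i.+2.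
  rewrite (reindex_inj (@ordS_inj N)) /V mulr_sumr; apply: eq_bigr => j _.
  by rewrite ordSK gauss_ordS // mulrA.
have VC' : \sum_(j < N) gauss N i.+1 (j%:R + k%:~R) * v (ordS j) 0
    = expi (- (2 * hang R N i)) * V i.
  rewrite (reindex_inj (@ord_pred_inj N)) /V mulr_sumr; apply: eq_bigr => j _.
  rewrite ord_predK -[in RHS](ord_predK j) gauss_ordS // ord_predK.
  by rewrite !mulrA expiNM mul1r.
have VD : \sum_(j < N) gauss N i.+1 (j%:R + k%:~R) *
     ((cos (2 * pi * j%:R / N%:R + 2 * pi / N%:R * k%:~R))%:C * v j 0)
    = (V i.+2 + V i) / 2.
  rewrite /V /gauss_sum sumrD mulr_suml; apply: eq_bigr => j _ /=.
  have -> : 2 * pi * j%:R / N%:R + 2 * pi / N%:R * k%:~R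
     = 2 * pi * (j%:R + k%:~R) / N%:R :> R by field.
  rewrite cos_expi -[gauss N i.+2 _]gaussS //.
  have e := gaussS N0 i (j%:R + k%:~R : R).
  have -> : gauss N i (j%:R + k%:~R : R) =
     gauss N i.+1 (j%:R + k%:~R) * expi (- (2 * pi * (j%:R + k%:~R) / N%:R)).
    by rewrite -e -mulrA [expi _ * _]mulrC expiNM mulr1.
  ring.
have zV : z * V i.+1 = expi phi / 2 * (expi (2 * hang R N i.+1) * V i.+2
    + expi (- (2 * hang R N i)) * V i) + (V i.+2 + V i) / 2.
  rewrite -VC -VC' -VD sumrD /V /gauss_sum !mulr_sumr sumrD.
  apply: eq_bigr => j _; have := congr1 (fun w : 'cV_N => w j 0) Av.
  rewrite mul_Amx_col [RHS]mxE => e; rewrite mulrCA -e; ring.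
rewrite -mulrA zV conj_expi /fwd /bwd !cos_expi.
have expi_half : expi phi = expi (phi / 2) * expi (phi / 2).
  by rewrite -expiD; congr expi; field.
have expi_hang a : expi (2 * a) = expi a * expi a :> R[i].
  by rewrite -expiD; congr expi; ring.
have expi_hangN a : expi (- (2 * a)) = expi (- a) * expi (- a) :> R[i].
  by rewrite -expiD; congr expi; ring.
rewrite !opprD !opprK !expiD !expi_hang !expi_hangN expi_half.
set p := expi (phi / 2); set q := expi (- (phi / 2)).
have pq : q * p = 1 by exact: expiNM.
set h := expi (hang R N i); set h' := expi (- hang R N i).
have hh : h' * h = 1 by exact: expiNM.
set g := expi (hang R N i.+1); set g' := expi (- hang R N i.+1).
have gg : g' * g = 1 by exact: expiNM.
(* Both sides are written so that they agree once [q * p], [h' * h] and [g' * g] are replaced by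
   1. *)
transitivity ((q * p) * p / 2 * (g * g * V i.+2 + h' * h' * V i) + q * (V i.+2 + V i) / 2).
  by ring.
transitivity ((p * (h' * h' * V i) + q * (h' * h) * V i
   + p * (g * g * V i.+2) + q * (g' * g) * V i.+2) / 2); last by ring.
by rewrite pq hh gg; ring.
Qed.

(** Since [gauss N i x] is the i-th power of a node times the nonvanishing [gauss N 0 x], the
    transform is an invertible Vandermonde matrix times an invertible diagonal one. *)
Lemma gauss_inj (R : realType) (N : nat) (k : int) (v : 'cV[R[i]]_N) :
  (0 < N)%N -> 
  (forall i, (i < N)%N -> gauss_sum k v i = 0) ->
  v = 0.
Proof.
move=> N0 hV.
pose a : 'rV[R[i]]_N := \row_j expi (2 * pi * (j%:R + k%:~R) / N%:R).
have gE i (x : R) : gauss N i x = expi (2 * pi * x / N%:R) ^+ i * gauss N 0 x.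
  by elim: i => [|i IH]; rewrite ?mul1r // -gaussS // IH exprS; ring.
have unitV : Vandermonde N a \in unitmx.
  rewrite unitmxE det_Vandermonde unitfE; apply/prodf_neq0 => i _.
  apply/prodf_neq0 => j ij; rewrite !mxE subr_eq0; exact: fourier_node_neq.
have : Vandermonde N a *m (\col_j (gauss N 0 (j%:R + k%:~R) * v j 0)) = 0.
  apply/matrixP => i l; rewrite !mxE -[RHS](hV i (ltn_ord i)).
  by apply: eq_bigr => j _; rewrite !mxE [in RHS]gE mulrA.
move=> /(congr1 (mulmx (invmx (Vandermonde N a)))); rewrite mulKmx // mulmx0.
move=> /matrixP u0; apply/matrixP => j l; rewrite ord1.
have := u0 j 0; rewrite !mxE /gauss => /eqP.
set t := (_ / _); rewrite mulf_eq0 => /orP[/eqP e|/eqP->//].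
by have := expiNM t; rewrite e mulr0 => /esym/eqP; rewrite oner_eq0.
Qed.

(** * Numerical range and conclusion *)

Local Open Scope classical_set_scope.

Lemma norm_expi (R : realType) (a t : R) : `|expi a * t%:C| = `|t|%:C.
Proof.
rewrite normrM normc_def /= cos2Dsin2 sqrtr1 mul1r normc_def /=.
by rewrite expr0n addr0 sqrtr_sqr.
Qed.

Lemma expi_pihalf (R : realType) (a t : R) :
  expi (a + pi / 2) * t%:C = expi a * (0 +i* t).
Proof.
by rewrite /expi cosDpihalf sinDpihalf; simpc; congr (_ +i* _); ring.
Qed.

Lemma numerical_range (R : realType) (N : nat) (phi theta : R)
    (v : 'cV[R[i]]_N) (z : R[i]) :
  Amx N phi theta *m v = z *: v -> v != 0 ->
  exists n r d : R, [/\ 0 < n, `|r| <= n, `|d| <= n &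
    z * n%:C = expi phi * r%:C + d%:C].
Proof.
move=> Av v0.
pose q j := complex.Re (v j 0) ^+ 2 + complex.Im (v j 0) ^+ 2.
pose p j := complex.Re (v j 0) * complex.Re (v (ordS j) 0)
  + complex.Im (v j 0) * complex.Im (v (ordS j) 0).
pose c (j : 'I_N) : R := cos (2 * pi * j%:R / N%:R + theta).
have q0 j : 0 <= q j by rewrite addr_ge0 ?sqr_ge0.
(* These are |v|^2, <C v, v> and <D v, v> in real coordinates. *)
exists (\sum_j q j), (\sum_j p j), (\sum_j c j * q j); split.
- rewrite lt_def sumr_ge0 ?andbT // psumr_neq0 //; apply/hasP.
  have [j vj] : exists j, v j 0 != 0.
    apply/existsP; apply: contraNT v0; rewrite negb_exists => /forallP v0.
    by apply/eqP/matrixP => i l; rewrite ord1 mxE; apply/eqP; move: (v0 i); rewrite negbK.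
  exists j; rewrite ?mem_index_enum //= lt_def q0 andbT.
  apply: contraNneq vj => /eqP; rewrite paddr_eq0 ?sqr_ge0 // !sqrf_eq0.
  by rewrite eq_complex.
- have qS : \sum_j q (ordS j) = \sum_j q j by rewrite [RHS](reindex_inj (@ordS_inj N)).
  have -> : \sum_j q j = \sum_j (q j + q (ordS j)) / 2.
    by rewrite -mulr_suml -[X in _ = X / 2]sumrD qS; field.
  apply: le_trans (ler_norm_sum _ _ _) _; apply: ler_sum => j _; rewrite /p /q.
  set x := complex.Re _; set y := complex.Im _; set x' := complex.Re _; set y' := complex.Im _.
  have h1 := sqr_ge0 (x - x'); have h2 := sqr_ge0 (y - y').
  have h3 := sqr_ge0 (x + x'); have h4 := sqr_ge0 (y + y').
  by rewrite ler_norml; apply/andP; split; nra.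
- apply: le_trans (ler_norm_sum _ _ _) _; apply: ler_sum => j _.
  by rewrite normrM (ger0_norm (q0 j)) ler_piMl // cos_max.
have conjM (a b : R[i]) : conjc a * b + conjc b * a =
    2 * (complex.Re a * complex.Re b + complex.Im a * complex.Im b)%:C.
  case: a b => [a1 a2] [b1 b2] /=; apply/eqP; rewrite eq_complex /=; apply/andP.
  by split; apply/eqP; ring.
have conjMid (a : R[i]) : conjc a * a = (complex.Re a ^+ 2 + complex.Im a ^+ 2)%:C.
  case: a => [a1 a2] /=; apply/eqP; rewrite eq_complex /=; apply/andP.
  by split; apply/eqP; ring.
have pE : \sum_j conjc (v j 0) * (v (ord_pred j) 0 + v (ordS j) 0)
    = 2 * (\sum_j p j)%:C.
  under eq_bigr => j _ do rewrite mulrDr.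
  rewrite -sumrD [X in X + _](reindex_inj (@ordS_inj N)) sumrD rmorph_sum mulr_sumr.
  by apply: eq_bigr => j _; rewrite ordSK addrC conjM.
transitivity (\sum_j conjc (v j 0) * (Amx N phi theta *m v) j 0).
  rewrite Av rmorph_sum mulr_sumr; apply: eq_bigr => j _.
  by rewrite mxE mulrCA conjMid.
transitivity (expi phi / 2 * (2 * (\sum_j p j)%:C) + (\sum_j c j * q j)%:C); last first.
  by congr (_ + _); field.
rewrite -pE [in RHS]rmorph_sum mulr_sumr sumrD; apply: eq_bigr => j _.
rewrite mul_Amx_col mulrDr mulrCA; congr (_ + _).
by rewrite mulrCA conjMid rmorphM.
Qed.

(** Rotation by exp(-i phi/2) carries the cross to the two coordinate axes, where Z^* = Z or Z^* =
    -Z. Off the axes the transform of v vanishes, contradicting that v is nonzero. *)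
Lemma spec_sub_cross (R : realType) (N : nat) (phi : R) (k : int) (z : R[i]) :
  (0 < N)%N -> ~~ odd N -> spec (Amx N phi (2 * pi / N%:R * k%:~R)) z ->
  cross (phi / 2) z.
Proof.
move=> N0 evN /specP[v Av v0].
pose Z := expi (- (phi / 2)) * z.
have zE : z = expi (phi / 2) * Z by rewrite mulrA -{1}[phi / 2]opprK expiNM mul1r.
have [ZR|ZnR] := eqVneq (Num.conj Z) Z.
  left; exists (complex.Re Z) => //; rewrite zE; congr (_ * _).
  move: ZR; case: (Z) => a b /(congr1 (@complex.Im R)) /= h.
  by have -> : b = 0 by lra.
have [ZI|ZnI] := eqVneq (Num.conj Z) (- Z).
  right; exists (complex.Im Z) => //; rewrite expi_pihalf zE; congr (_ * _).
  move: ZI; case: (Z) => a b /(congr1 (@complex.Re R)) /= h.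
  by have -> : a = 0 by lra.
case/eqP: v0; apply: (gauss_inj (k := k)) => // i iN.
apply: (periodic_chain_vanish N0 evN ZnR ZnI _ (gauss_chain N0 evN Av)) => // j.
apply: eq_bigr => l _.
by have := gauss_periodic R N0 j (l%:Z + k); rewrite rmorphD /= -pmulrn => ->.
Qed.

Unset Implicit Arguments.
Set Strict Implicit.

Theorem theorem1p1 (R : realType) (N : nat) (phi theta : R)
  (hN : (4 <= N)%N) (hNeven : ~~ odd N)
  (htheta : exists k : int, theta = 2 * pi / N%:R * k%:~R) :
  spec (Amx N phi theta) `<=` cross (phi / 2) /\
  (forall z : R[i], z \in spec (Amx N phi theta) ->
    (z \in cline (phi / 2) -> `|z| <= (2 * `|cos (phi / 2)|)%:C) /\
    (z \in cline (phi / 2 + pi / 2) -> `|z| <= (2 * `|sin (phi / 2)|)%:C)).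
Proof.
have N0 : (0 < N)%N by apply: leq_trans hN.
case: htheta => k ->; split; first by move=> z; apply: spec_sub_cross.
move=> z; rewrite inE => /specP[v Av v0].
have [n [r [d [n0 rn dn zn]]]] := numerical_range Av v0.
have phiE : expi phi = expi (phi / 2) * expi (phi / 2).
  by rewrite -expiD; congr expi; field.
(* The right side has real part cos(phi/2) (r + d) and imaginary part sin(phi/2) (r - d), whence the
   two bounds. *)
have zn' w : z = expi (phi / 2) * w ->
    w * n%:C = expi (phi / 2) * r%:C + expi (- (phi / 2)) * d%:C.
  move=> zw; have := congr1 (GRing.mul (expi (- (phi / 2)))) zn.
  by rewrite zw phiE mulrDr !mulrA expiNM !mul1r.
have bound (t x u : R) : t * n = x * u -> `|u| <= 2 * n -> `|t| <= 2 * `|x|.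
  move=> txu un; rewrite -(ler_pM2r n0) -[X in _ * X <= _](gtr0_norm n0) -normrM txu.
  by rewrite normrM -mulrA mulrCA ler_wpM2l.
split; rewrite inE => -[t _ zt]; rewrite -zt norm_expi lecR.
- have /(congr1 (@complex.Re R)) := zn' _ (esym zt).
  rewrite /= cosN => tn; apply: (bound _ _ (r + d)); first by lra.
  by apply: le_trans (ler_normD _ _) _; lra.
- have /(congr1 (@complex.Im R)) := zn' _ (etrans (esym zt) (expi_pihalf _ _)).
  rewrite /= sinN => tn; apply: (bound _ _ (r - d)); first by lra.
  by apply: le_trans (ler_normB _ _) _; lra.
Qed.
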